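(* Let $(E,d)$ be a compact metric space, and let $f$ be a continuous function from $E$ into the dual $\Phi'$ of a countably normed perfect space $\Phi=\bigcap_{n=1}^\infty\mathcal H_n$, where $\Phi'$ is endowed with the strong topology. Then there exists $p\in\mathbb N$ such that $f(E)\subset\mathcal H_p'$ and $f$ is uniformly continuous from $E$ into $\mathcal H_p'$, the latter being endowed with its norm-induced topology.
   Context: $\Phi$ is a vector space over $\mathbb R$ or $\mathbb C$ endowed with an increasing sequence of norms $\|\cdot\|_1\le\|\cdot\|_2\le\cdots$, each defined by an inner product; $\mathcal H_p$ is the Hilbert space completion of $\Phi$ with respect to $\|\cdot\|_p$. It is assumed that for $p\le q$ the natural map $\mathcal H_q\to\mathcal H_p$ is injective, so that $\mathcal H_q\subset\mathcal H_p$. $\Phi$ carries the projective limit topology defined by the norms, and it is complete if and only if $\Phi=\bigcap_{n\ge1}\mathcal H_n$. The topological dual is $\Phi'=\bigcup_{n\ge1}\mathcal H_n'$, where $\mathcal H_n'$ is the topological dual of $\mathcal H_n$ with the dual norm $\|v\|_{\mathcal H_n'}=\sup_{\|u\|_n=1}|\langle v,u\rangle|$. The strong topology on $\Phi'$ is that of uniform convergence on bounded subsets of $\Phi$. A complete countably normed space $\Phi$ is called perfect (or a Montel space) when any subset of $\Phi$ is bounded and closed if and only if it is compact. The paper takes the following as a necessary condition for $\Phi$ to be perfect, so that it is in force for every perfect space considered: for every $r\in\mathbb N$ there exists $p>r$ such that the inclusion from $\mathcal H_p$ into $\mathcal H_r$ is compact. *)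

(* Defs.v *)
From HB Require Import structures.
From mathcomp Require Import all_boot all_order all_algebra sesquilinear.
From mathcomp Require Import all_classical all_reals all_analysis.
From mathcomp Require Import complex.

Set Implicit Arguments.
Unset Strict Implicit.
Unset Printing Implicit Defensive.

Import Order.TTheory GRing.Theory Num.Theory.
Import numFieldNormedType.Exports.

Local Open Scope classical_set_scope.
Local Open Scope ring_scope.

(* The spaces are over the real or the complex numbers.  Norms in the sense of
   [normedModType K] take values in [K]; [realpart] brings them back to [R]. *)
Variant scalar_kind := RealScalars | ComplexScalars.

Definition scalars (R : realType) (k : scalar_kind) : numFieldType :=
  match k with
  | RealScalars => R
  | ComplexScalars => R[i]
  end.

Definition conjugate (R : realType) (k : scalar_kind) :
    scalars R k -> scalars R k :=
  match k with
  | RealScalars => fun a : R => a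
  | ComplexScalars => fun a : R[i] => conjc a
  end.

Definition realpart (R : realType) (k : scalar_kind) : scalars R k -> R :=
  match k with
  | RealScalars => fun a : R => a
  | ComplexScalars => fun a : R[i] => complex.Re a
  end.

Section topological_modules.
Context {K : numFieldType}.
Implicit Types V : preTopologicalLmodType K.

(* [r : K] being positive, it is real even when [K] is complex. *)
Definition absorbs V (U B : set V) : Prop :=
  exists2 r : K, 0 < r & forall a : K, r <= `|a| -> B `<=` [set a *: u | u in U].

Definition tvs_bounded V (B : set V) : Prop :=
  forall U : set V, nbhs 0 U -> absorbs U B.

Definition continuous_functional V : set (V -> K) :=
  [set v : V -> K | scalar v /\ continuous v].

Definition dual V := set_type (@continuous_functional V).

(* The functionals, as a subspace of the space of functions with the topology
   of uniform convergence on bounded sets. *)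
Definition strong_dual V := set_type
  (@continuous_functional V : set {family @tvs_bounded V, V -> K}).

HB.instance Definition _ V := Uniform.on (strong_dual V).

Definition compact_operator (V W : normedModType K) (T : V -> W) : Prop :=
  forall B : set V, bounded_set B -> precompact (T @` B).

End topological_modules.

Definition dual_norm (R : realType) (k : scalar_kind)
    (V : normedModType (scalars R k)) (v : V -> scalars R k) : R :=
  sup [set realpart `|v u| | u in [set u : V | `|u| = 1]].

(* [cn_hilbert n] is the completion of the space for the n-th norm, given by an
   isometric embedding [cn_incl n] with dense range; it is unique up to a unique
   isometry.  Density also makes [cn_map] unique.  Indices start at 0. *)
Record countably_normed (R : realType) (k : scalar_kind) := CountablyNormed {
  cn_lmod : lmodType (scalars R k) ;
  cn_dot : nat -> {dot cn_lmod for @conjugate R k} ;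
  cn_norm := fun n (u : cn_lmod) => Num.sqrt (realpart (cn_dot n u u)) ;
  cn_norm_homo : forall n u, cn_norm n u <= cn_norm n.+1 u ;
  cn_hilbert : nat -> completeNormedModType (scalars R k) ;
  cn_incl : forall n, {linear cn_lmod -> cn_hilbert n} ;
  cn_incl_isometry : forall n u, realpart `|cn_incl n u| = cn_norm n u ;
  cn_incl_dense : forall n, dense (range (cn_incl n)) ;
  cn_map : forall p q, (p <= q)%N -> {linear cn_hilbert q -> cn_hilbert p} ;
  cn_map_continuous : forall p q (pq : (p <= q)%N), continuous (cn_map pq) ;
  cn_map_incl : forall p q (pq : (p <= q)%N) u,
    cn_map pq (cn_incl q u) = cn_incl p u ;
  cn_map_inj : forall p q (pq : (p <= q)%N), injective (cn_map pq)
}.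

Section countably_normed_spaces.
Context {R : realType} {k : scalar_kind}.
Implicit Type Phi : countably_normed R k.

Definition cn_family Phi (u : cn_lmod Phi) : prod_topology (cn_hilbert Phi) :=
  fun n => cn_incl Phi n u.

(* The space itself, with the projective limit topology. *)
Definition cn_space Phi : Type := cn_lmod Phi.

HB.instance Definition _ Phi := GRing.Lmodule.on (cn_space Phi).
HB.instance Definition _ Phi :=
  Uniform.copy (cn_space Phi) (initial_topology (@cn_family Phi)).

Definition cn_complete Phi : Prop :=
  forall F : set_system (cn_space Phi), ProperFilter F -> cauchy F ->
    exists u : cn_space Phi, F --> u.

Definition perfect Phi : Prop :=
  cn_complete Phi /\
  forall A : set (cn_space Phi), tvs_bounded A /\ closed A <-> compact A.

(* A standing assumption, kept apart from [perfect]: it does not follow from the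
   Montel property alone. *)
Definition compact_inclusions Phi : Prop :=
  forall r, exists p, exists rp : (r < p)%N,
    compact_operator (cn_map Phi (ltnW rp)).

End countably_normed_spaces.

(* Main.v *)
Require Import Defs.
From mathcomp Require Import all_boot all_order all_algebra.
From mathcomp Require Import all_classical all_reals all_analysis.
From mathcomp Require Import complex.
Import Order.TTheory GRing.Theory Num.Theory.
Import numFieldNormedType.Exports.
Local Open Scope classical_set_scope.
Local Open Scope ring_scope.

(** The values of [f] are first put in a single dual, with a single bound.  A
    strongly continuous function on a compact space is bounded on [E * B] for
    every bounded set [B] ([strongly_bounded_range]).  If no index [n] gave a
    bound [|f x u| <= n * |u|_n], one could pick [u_n] in the unit ball of the
    [n]-th norm and [x_n] with [|f x_n u_n| > n].  Since the norms increase, all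
    but finitely many [u_n] lie in the unit ball of any given norm, so the [u_n]
    form a bounded set, on which [f] is unbounded: a contradiction
    ([uniform_norm_bound]).  Every [f x] therefore extends by density to a
    functional [h x] on the [n]-th Hilbert space, of norm at most [n]
    ([bounded_linear_extension]).

    Norm continuity is gained by restricting.  Let [p > n] be such that the
    inclusion [T] of the [p]-th Hilbert space into the [n]-th is compact, and
    put [g x = h x \o T].  The dual norm of [g x - g y] is the supremum of
    [|h x - h y|] over the image under [T] of the unit sphere, which is
    relatively compact.  Now the [h x] are equi-Lipschitz and, evaluated at the
    vectors of the dense image of the space, continuous in [x]; for such a
    family pointwise convergence is uniform on compact sets
    ([uniform_cvg_on_compact]).  So [g] is continuous for the dual norm, and, [E]
    being compact, uniformly continuous ([compact_lebesgue_number]). *)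

(** * Real and complex scalars *)

(** With this section of [realpart], inequalities between norms, whose values
    are scalars, become inequalities between real numbers. *)
Definition of_real {R : realType} {k : scalar_kind} : R -> scalars R k :=
  match k with
  | RealScalars => fun a : R => a
  | ComplexScalars => fun a : R => a%:C%C
  end.

Lemma realpartK {R : realType} {k : scalar_kind} (a : scalars R k) :
  0 <= a -> of_real (realpart a) = a.
Proof. by case: k a => //= -[a b]; rewrite lecE /= => /andP[/eqP->]. Qed.

Lemma ler_of_real {R : realType} {k : scalar_kind} (a b : R) :
  (@of_real R k a <= of_real b) = (a <= b).
Proof. by case: k => //=; rewrite lecR. Qed.

Lemma ltr_of_real {R : realType} {k : scalar_kind} (a b : R) :
  (@of_real R k a < of_real b) = (a < b).
Proof. by case: k => //=; rewrite ltcR. Qed.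

Lemma of_real0 {R : realType} {k : scalar_kind} : @of_real R k 0 = 0.
Proof. by case: k. Qed.

Lemma of_real_nat {R : realType} {k : scalar_kind} n : @of_real R k n%:R = n%:R.
Proof. by case: k => //=; rewrite rmorph_nat. Qed.

Lemma scalars_archi {R : realType} {k : scalar_kind} (a : scalars R k) :
  0 <= a -> exists n, a <= n%:R.
Proof.
move=> a0; exists (Num.bound `|realpart a|).
rewrite -{1}(realpartK a a0) -of_real_nat ler_of_real (le_trans (ler_norm _))//.
by rewrite ltW// archi_boundP.
Qed.

(** The real and imaginary parts are nonexpansive additive maps, so they send a
    Cauchy filter to Cauchy filters of real numbers; the limit is assembled from
    the two limits. *)
Lemma complex_complete {R : realType} (F : set_system (R[i] : numFieldType)) :
  ProperFilter F -> cauchy F -> cvg F.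
Proof.
move=> FF /cauchyP Fc.
have i1 : `|'i%C : R[i]| = 1 by rewrite normc_def/= expr0n expr1n add0r sqrtr1.
have part (h : {additive R[i] -> R}) :
    (forall z, (`|h z|)%:C%C <= `|z|) -> cvg (h @ F).
  move=> hn; apply: R_complete; apply: cauchy_exP => e.
  rewrite -ltcR => /Fc[z Fz]; exists (h z).
  apply: (@filterS _ F _ (ball z e%:C%C)) => // y.
  rewrite /= /ball/= -raddfB -ltcR.
  exact: le_lt_trans.
have /cvg_ex[a /cvgrPdist_lt Fa] : cvg (@complex.Re R @ F).
  by apply: part => z; exact: normc_ge_Re.
have /cvg_ex[b /cvgrPdist_lt Fb] : cvg (@complex.Im R @ F).
  apply: part => z; rewrite -normrN.
  have -> : - complex.Im z = complex.Re (z * 'i%C) by rewrite ReiNIm.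
  apply: le_trans (normc_ge_Re _) _.
  by rewrite normrM i1 mulr1.
apply/cvg_ex; exists (a%:C%C + 'i%C * b%:C%C); apply/cvgrPdist_lt => e e0.
have ee : (complex.Re e)%:C%C = e := @realpartK R ComplexScalars e (ltW e0).
have r0 : 0 < complex.Re e / 2 by rewrite divr_gt0// -ltcR ee.
have normcR (x : R) : `|x%:C%C| = `|x|%:C%C :> R[i].
  by rewrite normc_def/= expr0n addr0 sqrtr_sqr.
near=> z.
have -> : a%:C%C + 'i%C * b%:C%C - z
    = (a - complex.Re z)%:C%C + 'i%C * (b - complex.Im z)%:C%C :> R[i].
  by rewrite {1}(complexE z) !rmorphB/= mulrBr opprD addrACA.
rewrite (le_lt_trans (ler_normD _ _))// normrM i1 mul1r !normcR -ee.
rewrite (splitr (complex.Re e)) -rmorphD ltcR.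
by rewrite ltrD//; near: z; [exact: Fa|exact: Fb].
Unshelve. all: by end_near. Qed.

Lemma scalars_complete {R : realType} {k : scalar_kind}
    (F : set_system (scalars R k)) :
  ProperFilter F -> cauchy F -> cvg F.
Proof. by case: k F => F; [exact: R_complete|exact: complex_complete]. Qed.

(** * Bounded linear maps on a dense subspace *)

Lemma dense_approx {K : numFieldType} {H : normedModType K} (D : set H) :
  dense D -> forall (v : H) (d : K), 0 < d -> exists2 w, D w & `|v - w| < d.
Proof.
move=> DD v d d0; have [w [vw Dw]] : (ball v d `&` D) !=set0.
  by apply: DD; [exists v; exact: ballxx|exact: ball_open].
by exists w => //; move: vw; rewrite -ball_normE.
Qed.

Lemma le_of_small_errors {K : numFieldType} (x y M : K) : 0 <= M ->
  (forall d, 0 < d -> x <= y + M * d) -> x <= y.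
Proof.
move=> M0 xy; have M1 : 0 < M + 1 by rewrite ltr_wpDl.
have xyr e : 0 < e -> x <= y + e.
  move=> e0; apply: le_trans (xy (e / (M + 1)) _) _; first by rewrite divr_gt0.
  by rewrite lerD2l mulrCA ger_pMr// ler_pdivrMr// mul1r lerDl.
exact/ler_addgt0Pr.
Qed.

(** The value at [v] is the limit of [f u] as [i u] tends to [v], along a filter
    that the bound on [f] makes Cauchy.  In the limit the bound becomes
    [|g v - f u| <= C * |v - i u|] for all [u].  This estimate alone
    characterizes [g v]: linearity, the extension property and the bound on [g]
    all follow by approximating vectors by elements of the range of [i]. *)
Lemma bounded_linear_extension {K : numFieldType} {V : lmodType K}
    {H W : normedModType K}
    (W_complete : forall F : set_system W, ProperFilter F -> cauchy F -> cvg F)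
    (i : {linear V -> H}) (i_dense : dense (range i))
    (f : V -> W) (f_linear : linear f) (C : K) (C_ge0 : 0 <= C)
    (f_bound : forall u, `|f u| <= C * `|i u|) :
  exists g : H -> W, [/\ linear g, forall u, g (i u) = f u &
    forall v, `|g v| <= C * `|v|].
Proof.
have fB u u' : f u - f u' = f (u - u').
  by rewrite -[u - u']addrC -scaleN1r f_linear scaleN1r addrC.
have approx v d : 0 < d -> exists u, `|v - i u| < d.
  by move=> /(dense_approx _ i_dense v)[_ [u _ <-]]; exists u.
have /choice[g gf] : forall v, exists l : W,
    forall u, `|l - f u| <= C * `|v - i u|.
  move=> v.
  pose F := filter_from (nbhs v) (fun A => f @` (i @^-1` A)).
  have Fball d : 0 < d -> F (f @` [set u | `|v - i u| < d]).
    move=> d0; exists (ball v d); first exact: nbhsx_ballx.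
    by rewrite -ball_normE.
  have FF : ProperFilter F.
    apply: filter_from_proper; last first.
      move=> A /nbhs_ballP[d /= d0]; rewrite -ball_normE => vA.
      by have [u /vA Au] := approx v d d0; exists (f u), u.
    apply: filter_from_filter; first by exists setT; exact: filterT.
    move=> A B vA vB; exists (A `&` B); first exact: filterI.
    by move=> _ [u [Au Bu] <-]; split; exists u.
  (* Both the Cauchy property and the estimate on the limit come from this. *)
  have near_diff u u' : `|f u - f u'| <= C * `|v - i u| + C * `|v - i u'|.
    rewrite fB (le_trans (f_bound _))// -mulrDr ler_wpM2l// raddfB/=.
    by rewrite (le_trans (ler_distD v _ _))// (distrC _ v).
  have /W_complete : cauchy F.
    apply: cauchy_exP => e e0.
    pose d := e / (C + C + 1).
    have C1 : 0 < C + C + 1 by rewrite ltr_wpDl// addr_ge0.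
    have d0 : 0 < d by rewrite divr_gt0.
    have [u vu] := approx v d d0; exists (f u).
    apply: filterS (Fball d d0) => _ [u' /= vu' <-].
    rewrite -ball_normE/= (le_lt_trans (near_diff u u'))//.
    apply: (@le_lt_trans _ _ (C * d + C * d)).
      by apply: lerD; apply: ler_wpM2l => //; apply: ltW.
    by rewrite -mulrDl mulrCA gtr_pMr// ltr_pdivrMr// mul1r ltrDl.
  move=> /cvg_ex[l Fl]; exists l => u.
  apply: (@le_of_small_errors _ _ _ (1 + C)); first by rewrite addr_ge0.
  move=> d d0.
  have /filter_ex[w [/= + [u' vu' fw]]] :
      F (ball l d `&` f @` [set u | `|v - i u| < d]).
    by apply: filterI; [exact: (Fl _ (nbhsx_ballx l d d0))|exact: Fball].
  rewrite -{}fw -ball_normE/= => lu.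
  rewrite mulrDl mul1r addrCA (le_trans (ler_distD (f u') _ _))//.
  rewrite lerD ?(ltW lu)// distrC (le_trans (near_diff _ _))//.
  by rewrite lerD2l ler_wpM2l// ltW.
have g_small a v w u u' : `|g (a *: v + w) - (a *: g v + g w)| <=
    (C + C) * (`|a| * `|v - i u| + `|w - i u'|).
  have -> : g (a *: v + w) - (a *: g v + g w) =
      (g (a *: v + w) - f (a *: u + u')) - (a *: (g v - f u) + (g w - f u')).
    by rewrite f_linear scalerBr addrACA -opprD opprB addrA subrK.
  rewrite (le_trans (ler_normB _ _))// mulrDl lerD//.
    rewrite (le_trans (gf _ _))// ler_wpM2l// linearP opprD addrACA -scalerBr.
    by rewrite (le_trans (ler_normD _ _))// normrZ.
  rewrite (le_trans (ler_normD _ _))// mulrDr lerD// normrZ mulrCA.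
  by rewrite ler_wpM2l.
exists g; split.
- move=> a v w; apply/eqP; rewrite -subr_eq0 -normr_le0.
  apply: (@le_of_small_errors _ _ _ ((C + C) * (`|a| + 1))).
    by rewrite mulr_ge0 ?addr_ge0.
  move=> d d0; have [u vu] := approx v _ d0; have [u' wu'] := approx w _ d0.
  rewrite (le_trans (g_small a v w u u'))// add0r -mulrA ler_wpM2l ?addr_ge0//.
  by rewrite mulrDl mul1r lerD ?(ltW wu')// ler_wpM2l// ltW.
- move=> u; apply/eqP; rewrite -subr_eq0 -normr_le0.
  by rewrite (le_trans (gf _ u))// subrr normr0 mulr0.
- move=> v; apply: (@le_of_small_errors _ _ _ (C + C)).
    by rewrite addr_ge0.
  move=> d d0; have [u vu] := approx v _ d0.
  rewrite -[g v](subrK (f u)) (le_trans (ler_normD _ _))//.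
  rewrite mulrDl addrCA lerD//.
    by rewrite (le_trans (gf _ _))// ler_wpM2l// ltW.
  rewrite (le_trans (f_bound _))// -mulrDr ler_wpM2l//.
  rewrite -[i u](subrK v) addrC (le_trans (ler_normD _ _))//.
  by rewrite distrC lerD2l ltW.
Qed.

(** * Bounded sets and the strong topology *)

Lemma cn_incl_le {R : realType} {k : scalar_kind} (Phi : countably_normed R k)
    (p q : nat) (u : cn_lmod Phi) :
  (p <= q)%N -> `|cn_incl Phi p u| <= `|cn_incl Phi q u|.
Proof.
move=> pq; rewrite -(realpartK `|cn_incl Phi p u|)//.
rewrite -(realpartK `|cn_incl Phi q u|)// ler_of_real !cn_incl_isometry.
elim: q pq => [|q IH]; first by rewrite leqn0 => /eqP->.
rewrite leq_eqVlt => /predU1P[->//|/IH]/le_trans; apply.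
exact: cn_norm_homo.
Qed.

(** Since the norms increase, constraints on finitely many of them follow from
    one constraint on the norm of largest index. *)
Lemma nbhs0_cn_space {R : realType} {k : scalar_kind}
    (Phi : countably_normed R k) (U : set (cn_space Phi)) :
  nbhs 0 U -> exists m, exists2 d : scalars R k, 0 < d &
    forall u, `|cn_incl Phi m u| < d -> U u.
Proof.
pose ball0 (q : nat * scalars R k) : set (cn_space Phi) :=
  [set u | `|cn_incl Phi q.1 u| < q.2].
pose G := filter_from (fun q : nat * scalars R k => 0 < q.2) ball0.
have GF : Filter G.
  apply: filter_from_filter; first by exists (0%N, 1) => /=.
  move=> [m d] [n e] /= d0 e0.
  have [c [c0 cd ce]] : exists c, [/\ 0 < c, c <= d & c <= e].
    have /orP[de|ed] : (d <= e) || (e <= d).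
      by apply: real_leVge; exact: gtr0_real.
      by exists d.
    by exists e.
  exists (maxn m n, c) => // u /= uc; split => /=.
    by apply: le_lt_trans (lt_le_trans uc cd); exact/cn_incl_le/leq_maxl.
  by apply: le_lt_trans (lt_le_trans uc ce); exact/cn_incl_le/leq_maxr.
suff : G --> (0 : cn_space Phi).
  by move=> GU /GU [[m d] d0 dU]; exists m, d.
have : @cn_family R k Phi @ G --> (@cn_family R k Phi 0).
  apply/cvg_sup => n A [_ [[B Bop <-] B0 BA]].
  have /nbhs_ballP[d /= d0 dB] : nbhs (cn_incl Phi n 0) B.
    exact: open_nbhs_nbhs.
  exists (n, d) => // u /= ud; apply/BA/dB.
  by rewrite -ball_normE/= /cn_family raddf0 sub0r normrN.
move=> Gf A [_ [[B Bop <-] B0 BA]].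
have /Gf : nbhs (@cn_family R k Phi 0) B by exact: open_nbhs_nbhs.
exact: (@filterS _ G).
Qed.

Lemma cn_bounded_tvs_bounded {R : realType} {k : scalar_kind}
    (Phi : countably_normed R k) (B : set (cn_space Phi)) :
  (forall m, exists M : scalars R k,
    forall u, B u -> `|cn_incl Phi m u| <= M) ->
  tvs_bounded B.
Proof.
move=> Bm U /nbhs0_cn_space[m [d d0 dU]]; have [M BM] := Bm m.
have [[u0 Bu0]|B0] := pselect (B !=set0); last first.
  by exists 1 => // a _ u Bu; case: B0; exists u.
have M0 : 0 <= M by rewrite (le_trans _ (BM _ Bu0)).
exists ((M + 1) / d); first by rewrite divr_gt0// ltr_wpDl.
move=> a ra u Bu.
have a0 : 0 < `|a| by rewrite (lt_le_trans _ ra)// divr_gt0// ltr_wpDl.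
have aN0 : a != 0 by rewrite -normr_gt0.
exists (a^-1 *: u); last by rewrite scalerA divff// scale1r.
apply: dU; rewrite linearZ/= normrZ normfV mulrC ltr_pdivrMr//.
rewrite (le_lt_trans (BM _ Bu))// mulrC.
by move: ra; rewrite ler_pdivrMr//; apply: lt_le_trans; rewrite ltrDl ltr01.
Qed.

Lemma functional_bounded {K : numFieldType} {V : preTopologicalLmodType K}
    (v : V -> K) (B : set V) : continuous_functional v -> tvs_bounded B ->
  exists2 M : K, 0 < M & forall u, B u -> `|v u| <= M.
Proof.
move=> [vlin vcont] Bb.
have v0 : v 0 = 0 by have := vlin (-1) 0 0; rewrite scaler0 add0r mulN1r addNr.
have vZ a u : v (a *: u) = a * v u by rewrite -[a *: u]addr0 vlin v0 addr0.
have : nbhs 0 [set u | `|v u| < 1].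
  have /cvgrPdist_lt/(_ 1 ltr01) := vcont 0.
  by apply: filterS => u /=; rewrite v0 sub0r normrN.
move=> /Bb[r r0 rB]; exists r => // u Bu.
have [|w /= w1 <-] := rB r _ u Bu; first by rewrite gtr0_norm.
by rewrite vZ normrM gtr0_norm// ger_pMr// ltW.
Qed.

Lemma strong_cvg_on_bounded {K : numFieldType} {V : preTopologicalLmodType K}
    {E : topologicalType} (f : E -> strong_dual V) (x : E) (B : set V) (e : K) :
  {for x, continuous f} -> tvs_bounded B -> 0 < e ->
  \forall y \near x, forall u, B u -> `|set_val (f x) u - set_val (f y) u| < e.
Proof.
move=> fx Bb e0.
have sv : continuous
    (set_val : strong_dual V -> {family @tvs_bounded K V, V -> K}).
  exact: initial_continuous.
have ent_e := entourage_ball K (PosNum e0).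
have := fx _ (sv _ _ (fam_nbhs (set_val (f x)) ent_e Bb)).
apply: (@filterS _ (nbhs x)) => y /= fxy u /fxy.
by rewrite -ball_normE.
Qed.

(** Each value of [f] is bounded on [B], being continuous and linear, and strong
    continuity keeps the values within 1 of each other on [B] near each point;
    compactness leaves finitely many such neighbourhoods. *)
Lemma strongly_bounded_range {K : numFieldType} {V : preTopologicalLmodType K}
    {E : topologicalType} (f : E -> strong_dual V) (B : set V) :
  compact [set: E] -> continuous f -> tvs_bounded B ->
  exists M : K, forall x u, B u -> `|set_val (f x) u| <= M.
Proof.
move=> /compact_near_coveringP Ecomp fcont Bb.
have : \forall M \near +oo,
    [set: E] `<=` (fun x => forall u, B u -> `|set_val (f x) u| <= M).
  apply: Ecomp => x _.
  have [M M0 fM] : exists2 M : K, 0 < M &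
      forall u, B u -> `|set_val (f x) u| <= M.
    by apply: functional_bounded => //; exact: set_valP.
  have M1 : M + 1 \is Num.real by rewrite gtr0_real// addr_gt0.
  near=> y t => u Bu.
  have Mt : M + 1 <= t by near: t; exact: nbhs_pinfty_ge.
  rewrite -[set_val (f y) u](subKr (set_val (f x) u)).
  apply: le_trans (ler_normB _ _) _.
  apply: le_trans Mt; apply: lerD; [exact: fM|apply: ltW].
  by move: u Bu; near: y; apply: strong_cvg_on_bounded => //; exact: fcont.
move=> /pinfty_ex_gt0[M _ fM]; exists M => x u Bu; exact: fM.
Unshelve. all: by end_near. Qed.

(** * Functions on a compact space *)

(** As the norms increase, vectors [u_n] with [n]-th norm at most 1 form a bounded
    set, on which [f] is bounded; so the values of [f] at [u_n] cannot exceed [n]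
    for every [n].  Strong continuity thus takes the place of a category
    argument. *)
Lemma uniform_norm_bound {R : realType} {k : scalar_kind}
    (Phi : countably_normed R k) {E : topologicalType}
    (f : E -> strong_dual (cn_space Phi)) :
  compact [set: E] -> continuous f ->
  exists n, forall x (u : cn_space Phi),
    `|set_val (f x) u| <= n%:R * `|cn_incl Phi n u|.
Proof.
move=> Ecomp fcont.
have [n nP] : exists n, forall x (u : cn_space Phi),
    `|cn_incl Phi n u| <= 1 -> `|set_val (f x) u| <= n%:R.
  apply: contrapT => /forallNP noBound.
  have /choice[xu xuP] : forall n, exists xu : E * cn_space Phi,
      `|cn_incl Phi n xu.2| <= 1 /\ ~ `|set_val (f xu.1) xu.2| <= n%:R.
    move=> n; have /existsNP[x /existsNP[u /not_implyP fxu]] := noBound n.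
    by exists (x, u).
  pose B : set (cn_space Phi) := range (fun n => (xu n).2).
  have Bb : tvs_bounded B.
    apply: cn_bounded_tvs_bounded => m.
    (* [S] takes care of the finitely many [n] below [m]. *)
    pose S := \sum_(i < m) `|cn_incl Phi m (xu i).2|.
    have S0 : 0 <= S by apply: sumr_ge0.
    exists (1 + S) => _ [n _ <-]; have [mn|nm] := leqP m n.
      rewrite (le_trans (cn_incl_le _ _ _ _ mn))// (le_trans (xuP n).1)//.
      by rewrite lerDl.
    rewrite ler_wpDl// /S (bigD1 (Ordinal nm))//= lerDl.
    by apply: sumr_ge0.
  have [M fM] := strongly_bounded_range f B Ecomp fcont Bb.
  have fxuM n : `|set_val (f (xu n).1) (xu n).2| <= M by apply: fM; exists n.
  have [n Mn] := scalars_archi M (le_trans (normr_ge0 _) (fxuM 0%N)).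
  by apply: (xuP n).2; exact: le_trans (fxuM n) Mn.
exists n => x u.
have [flin _] : continuous_functional (set_val (f x)) by exact: set_valP.
have f0 : set_val (f x) 0 = 0.
  by have := flin (-1) 0 0; rewrite scaler0 add0r mulN1r addNr.
(* [u] is scaled by its norm plus [d], positive even if the norm is 0. *)
apply: (@le_of_small_errors _ _ _ n%:R); first exact: ler0n.
move=> d d0; rewrite -mulrDr.
set s := _ + d; have s0 : 0 < s by rewrite ltr_wpDl.
have := nP x (s^-1 *: u).
rewrite -[s^-1 *: u]addr0 flin f0 !addr0 linearZ/= normrZ normrM normfV.
rewrite (gtr0_norm s0).
rewrite ![s^-1 * _]mulrC !ler_pdivrMr// mul1r; apply.
by rewrite lerDl ltW.
Qed.

(** Moving from [v] to a nearby [w] in [D] changes [g y v] by little, uniformly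
    in [y], so the convergence at [w] controls all [v] near [w]; finitely many
    [w] serve for [A]. *)
Lemma uniform_cvg_on_compact {K : numFieldType} {E : topologicalType}
    {H W : normedModType K} (g : E -> H -> W) (C : K) (D A : set H)
    (x : E) (e : K) :
  0 <= C -> (forall y v w, `|g y v - g y w| <= C * `|v - w|) ->
  dense D -> (forall w, D w -> (fun y => g y w) @ x --> g x w) ->
  compact A -> 0 < e ->
  \forall y \near x, forall v, A v -> `|g x v - g y v| < e.
Proof.
move=> C0 gC Ddense gD /compact_near_coveringP Acomp e0.
apply: Acomp => v Av.
pose d := e / (C + C + 1 + 1).
have C1 : 0 < C + C + 1 + 1 by rewrite ltr_wpDl// !addr_ge0.
have d0 : 0 < d by rewrite divr_gt0.
have [w Dw vw] := dense_approx D Ddense v d d0.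
have gwd : \forall y \near x, `|g x w - g y w| < d.
  by have /cvgrPdist_lt := gD w Dw; apply.
have vwd : \forall v' \near v, `|v' - w| < d.
  have : \forall v' \near v, ball w d v'.
    apply: open_nbhs_nbhs; split; first exact: ball_open.
    by rewrite -ball_normE/= distrC.
  by apply: filterS => v'; rewrite -ball_normE/= distrC.
near=> v' y => /=.
have v'w : `|v' - w| < d by near: v'.
have gyw : `|g x w - g y w| < d by near: y.
have Cd z : `|g z v' - g z w| <= C * d.
  by rewrite (le_trans (gC _ _ _))// ler_wpM2l// ltW.
have -> : e = C * d + (C * d + d) + d.
  have <- : (C + C + 1 + 1) * d = e by rewrite mulrC divfK ?gt_eqF.
  by rewrite !mulrDl mul1r !addrA.
apply: (@le_lt_trans _ _ (C * d + (C * d + d))); last by rewrite ltrDl.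
rewrite (le_trans (ler_distD (g x w) _ _))// lerD//.
rewrite (le_trans (ler_distD (g y w) _ _))// addrC lerD//; last exact: ltW.
by rewrite distrC.
Unshelve. all: by end_near. Qed.

(** The Lebesgue number of a cover: a relation that holds near the diagonal of a
    compact metric space holds on a strip of constant width around it. *)
Lemma compact_lebesgue_number {R : realType} {E : metricType R}
    (P : E -> E -> Prop) :
  compact [set: E] -> (forall x : E, \forall yz \near (x, x), P yz.1 yz.2) ->
  exists2 d : R, 0 < d & forall y z, mdist y z < d -> P y z.
Proof.
move=> /compact_near_coveringP Ecomp Pnear.
have : \forall d \near 0^'+,
    [set: E] `<=` (fun y => forall z, mdist y z < d -> P y z).
  apply: Ecomp => x _.
  have [[A B] /= [Ax Bx] AB] := Pnear x.
  have /nbhs_ballP[r /= r0 rAB] : nbhs x (A `&` B) by exact: filterI.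
  near=> y d => z yz.
  have dr : d < r / 2 by near: d; apply: nbhs_right_lt; rewrite divr_gt0.
  have xy : ball x (r / 2) y.
    by near: y; apply: nbhsx_ballx; rewrite divr_gt0.
  apply: (AB (y, z)); split => /=.
    apply: (rAB _ _).1; apply: le_ball xy.
    by rewrite ler_pdivrMr// ler_pMr// ler1n.
  apply: (rAB _ _).2; rewrite (splitr r); apply: ball_triangle xy _.
  by rewrite ballEmdist/= (lt_trans yz).
move=> Pd; near (0 : R)^'+ => d; exists d => // y z.
by move: y I z; near: d.
Unshelve. all: by end_near. Qed.

(** * Passage to the dual norm *)

Lemma bounded_scalar_lipschitz {K : numFieldType} {V : normedModType K}
    (v : V -> K) (C : K) :
  scalar v -> (forall u, `|v u| <= C * `|u|) ->
  forall u w, `|v u - v w| <= C * `|u - w|.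
Proof.
move=> vlin vC u w; rewrite (_ : v u - v w = v (u - w)) ?vC//.
by rewrite [u - w]addrC -[- w]scaleN1r vlin mulN1r addrC.
Qed.

Lemma lipschitz_continuous {K : numFieldType} {V W : normedModType K}
    (v : V -> W) (C : K) :
  0 <= C -> (forall u w, `|v u - v w| <= C * `|u - w|) -> continuous v.
Proof.
move=> C0 vC u; apply/cvgrPdist_lt => e e0.
have C1 : 0 < C + 1 by rewrite ltr_wpDl.
have Ce : 0 < e / (C + 1) by rewrite divr_gt0.
near=> w; rewrite (le_lt_trans (vC _ _))//.
have uw : `|u - w| < e / (C + 1) by near: w; exact: cvgr_dist_lt.
rewrite (le_lt_trans (ler_wpM2l C0 (ltW uw)))//.
by rewrite mulrCA gtr_pMr// ltr_pdivrMr// mul1r ltrDl.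
Unshelve. all: by end_near. Qed.

(** The case of an empty unit sphere, where the supremum is 0 by convention, is
    the reason for the hypothesis [0 <= e]. *)
Lemma dual_norm_le {R : realType} {k : scalar_kind}
    {V : normedModType (scalars R k)} (v : V -> scalars R k) (e : R) :
  0 <= e -> (forall u, `|u| = 1 -> `|v u| <= of_real e) -> dual_norm v <= e.
Proof.
move=> e0 ve; rewrite /dual_norm.
set S := [set _ | _ in _].
have [S0|/nonemptyPn S0] := pselect (S !=set0); last by rewrite S0 sup0.
apply: ge_sup => // _ [u /= u1 <-].
by rewrite -(@ler_of_real R k) realpartK ?ve.
Qed.

Theorem theorem3p1 (R : realType) (k : scalar_kind)
    (Phi : countably_normed R k)
    (Phi_perfect : perfect Phi) (Phi_compact : compact_inclusions Phi)
    (E : metricType R) (E_compact : compact [set: E])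
    (f : E -> strong_dual (cn_space Phi)) (f_continuous : continuous f) :
  exists (p : nat) (g : E -> dual (cn_hilbert Phi p)),
    (forall (x : E) (u : cn_space Phi),
      set_val (f x) u = set_val (g x) (cn_incl Phi p u)) /\
    (forall e : R, 0 < e -> exists2 d : R, 0 < d &
      forall x y : E, mdist x y < d ->
        dual_norm (set_val (g x) \- set_val (g y)) < e).
Proof.
have [n fn] := uniform_norm_bound Phi f E_compact f_continuous.
have [p [np Tcompact]] := Phi_compact n.
have /choice[h hP] : forall x, exists h : cn_hilbert Phi n -> scalars R k,
    [/\ scalar h, forall u, h (cn_incl Phi n u) = set_val (f x) u &
      forall v, `|h v| <= n%:R * `|v|].
  move=> x.
  have [flin _] : continuous_functional (set_val (f x)) by exact: set_valP.
  apply: (@bounded_linear_extension _ _ _ (scalars R k)^o) => //.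
  - exact: scalars_complete.
  - exact: cn_incl_dense.
pose T := cn_map Phi (ltnW np).
have n0 : 0 <= n%:R :> scalars R k by exact: ler0n.
have hB x v w : `|h x v - h x w| <= n%:R * `|v - w|.
  by have [hlin _ hn] := hP x; exact: bounded_scalar_lipschitz.
have gP x : continuous_functional (h x \o T).
  have [hlin _ _] := hP x; split.
    by move=> a v w /=; rewrite linearP hlin.
  move=> v; apply: continuous_comp; first exact: cn_map_continuous.
  exact: (@lipschitz_continuous _ _ (scalars R k)^o _ n%:R).
pose g x : dual (cn_hilbert Phi p) := SigSub (mem_set (gP x)).
exists p, g; split.
  move=> x u; have [_ <- _] := hP x.
  by congr (h x _); rewrite -(cn_map_incl (ltnW np)).
move=> e e0.
pose A := closure (T @` [set v | `|v| <= 1]).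
have A_compact : compact A.
  rewrite -precompactE; apply: Tcompact.
  exists 1; split; first exact: real1.
  by move=> M M1 v /= v1; exact: le_trans v1 (ltW M1).
pose r : scalars R k := of_real (e / 2).
have r0 : 0 < r by rewrite -of_real0 ltr_of_real divr_gt0.
have [d d0 dP] : exists2 d : R, 0 < d & forall y z : E, mdist y z < d ->
    forall v, A v -> `|h y v - h z v| <= r.
  pose P y z := forall v, A v -> `|h y v - h z v| <= r.
  apply: (compact_lebesgue_number P) => // x.
  have hx : \forall y \near x, forall v, A v -> `|h x v - h y v| < r / 2.
    apply: (@uniform_cvg_on_compact _ _ _ (scalars R k)^o h n%:R
      (range (cn_incl Phi n))) => //; first exact: cn_incl_dense.
      (* Strong continuity on a singleton, which is bounded. *)
      move=> _ [u _ <-]; apply/cvgrPdist_lt => t t0.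
      have ub : tvs_bounded [set (u : cn_space Phi)].
        apply: cn_bounded_tvs_bounded => m.
        by exists `|cn_incl Phi m u| => _ ->.
      have := strong_cvg_on_bounded f x _ _ (f_continuous x) ub t0.
      apply: filterS => y /(_ u erefl).
      by have [_ -> _] := hP x; have [_ -> _] := hP y.
    by rewrite divr_gt0.
  pose N y := forall v, A v -> `|h x v - h y v| < r / 2.
  exists (N, N) => //= -[y z] /= [Ny Nz] v Av; rewrite (splitr r).
  rewrite (le_trans (ler_distD (h x v) _ _))// lerD// ltW//; last exact: Nz.
  by rewrite distrC; exact: Ny.
exists d => // x y xy.
apply: (@le_lt_trans _ _ (e / 2)); last first.
  by rewrite ltr_pdivrMr// ltr_pMr// ltr1n.
apply: dual_norm_le; first by rewrite divr_ge0 ?ltW.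
move=> u u1 /=; apply: (dP x y xy); apply: subset_closure; exists u => //=.
by rewrite u1.
Qed.
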